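(* Let $G=(n,S,X)$ be a generic game. Assume there exists a point $p\in P_G$ such that its $k$-th slice in the $i$-th direction, $p_{-i,k}$, is nonzero for all $i\in[n]$ and $k\in[d_i]$. Then the correlated equilibrium polytope $P_G$ is either full-dimensional or a singleton.
   Context: **Games.** A game $G=(n,S,X)$ (in normal form) consists of $n\ge 2$ players, finite nonempty sets $S^{(i)}$ of pure strategies for $i\in[n]=\{1,\dots,n\}$, with $S=\prod_{i=1}^n S^{(i)}$, and real payoff tensors $X=(X^{(1)},\dots,X^{(n)})$, where $X^{(i)}_{j_1,\dots,j_n}\in\mathbb{R}$ is the payoff of player $i$ when each player $i'$ plays $j_{i'}\in S^{(i')}$. Write $d_i=|S^{(i)}|$, identify $S^{(i)}=[d_i]$, and put $D=\prod_{i=1}^n d_i$. Identify $\mathbb{R}^D=\bigotimes_{i=1}^n\mathbb{R}^{d_i}$ and let $\Delta_{D-1}\subseteq\mathbb{R}^D$ be the probability simplex. **Slices and linear forms.** For $p\in\mathbb{R}^D$, $i\in[n]$, $k\in[d_i]$, let $p_{-i,k}\in\mathbb{R}^{D/d_i}=\bigotimes_{i'\ne i}\mathbb{R}^{d_{i'}}$ be the $k$-th slice of $p$ in the $i$-th direction, i.e. the tensor of entries $p_{j_1,\dots,j_{i-1},k,j_{i+1},\dots,j_n}$. For $k,\ell\in[d_i]$ define the linear form on $\mathbb{R}^{D/d_i}$ $$H^{X^{(i)}}_{k,\ell}(q)=\sum_{j\in\prod_{i'\neq i}[d_{i'}]}\bigl(X^{(i)}_{j_1,\dots,j_{i-1},k,j_{i+1},\dots,j_n}-X^{(i)}_{j_1,\dots,j_{i-1},\ell,j_{i+1},\dots,j_n}\bigr)\,q_j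 .$$ **Correlated equilibria.** $P_G\subseteq\Delta_{D-1}$ is the set of all $p\in\Delta_{D-1}$ satisfying the incentive constraints $H^{X^{(i)}}_{k,\ell}(p_{-i,k})\ge 0$ for all $i\in[n]$ and $k,\ell\in[d_i]$; it is a convex polytope. It is called full-dimensional if its dimension is $D-1$. **Genericity.** Let $A_G$ be the matrix with $D$ columns whose rows are the coefficient vectors (in the variable $p\in\mathbb{R}^D$) of all linear forms $p\mapsto H^{X^{(i)}}_{k,\ell}(p_{-i,k})$ ($i\in[n]$, $k\neq\ell\in[d_i]$) and of all coordinate forms $p\mapsto p_{j_1,\dots,j_n}$. Its entries are polynomials in the payoffs. The game $G$ is generic if every $D\times D$ minor of $A_G$ that is not identically zero as a polynomial in the payoffs is nonzero at the payoff tuple $X$ of $G$. *)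

(* Defs.v *)
From HB Require Import structures.
From mathcomp Require Import all_boot all_order all_algebra.
From mathcomp Require Import boolp classical_sets reals.
From mathcomp Require Import mpoly.

Set Implicit Arguments.
Unset Strict Implicit.
Unset Printing Implicit Defensive.

Import Order.TTheory GRing.Theory Num.Theory.
Local Open Scope ring_scope.
Local Open Scope classical_set_scope.

Section Games.
Variables (n : nat) (d : 'I_n -> nat).

Definition profile := {dffun forall i : 'I_n, 'I_(d i)}.

(* The index set of the slices in direction i. *)
Definition opp_profile (i : 'I_n) :=
  {dffun forall u : {i' : 'I_n | i' != i}, 'I_(d (val u))}.

(* The profile (j_1, .., j_{i-1}, k, j_{i+1}, .., j_n). *)
Definition insert_strategy (i : 'I_n) (k : 'I_(d i)) (j : opp_profile i) :
    profile :=
  [ffun i' : 'I_n =>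
    match eqVneq i' i with
    | EqNotNeq e => ecast x 'I_(d x) (esym e) k
    | NeqNotEq ne => j (exist _ i' ne)
    end].

(* The forms and the matrix A_G are defined over an arbitrary commutative ring
   K, so as to be used both with K the reals and with K a polynomial ring whose
   indeterminates are the payoffs. The regular module K^o makes R^D a
   finite-dimensional vector space when K = R is a field. *)
Definition tensor (K : comNzRingType) := {ffun profile -> K^o}.

Definition payoffs (K : comNzRingType) := 'I_n -> tensor K.

Definition slice (K : comNzRingType) (p : tensor K) (i : 'I_n) (k : 'I_(d i)) :
    {ffun opp_profile i -> K} :=
  [ffun j => p (insert_strategy k j)].

Definition incentive_form (K : comNzRingType) (X : payoffs K) (i : 'I_n)
    (k l : 'I_(d i)) (q : {ffun opp_profile i -> K}) : K :=
  \sum_(j : opp_profile i)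
    (X i (insert_strategy k j) - X i (insert_strategy l j)) * q j.

(* Index set of the rows of A_G: triples (i, k, l) with k != l, and pure
   strategy profiles. *)
Definition deviation :=
  {r : {i : 'I_n & ('I_(d i) * 'I_(d i))%type} | (tagged r).1 != (tagged r).2}.

Definition row_index := (deviation + profile)%type.

Definition row_form (K : comNzRingType) (X : payoffs K) (r : row_index)
    (p : tensor K) : K :=
  match r with
  | inl u =>
      let k := (tagged (val u)).1 in
      let l := (tagged (val u)).2 in
      incentive_form X k l (slice p k)
  | inr s => p s
  end.

Definition basis_tensor (K : comNzRingType) (s : profile) : tensor K :=
  [ffun t => (t == s)%:R].

(* The coefficient of the variable p_s in a linear form is the value of the
   form at the basis tensor e_s. *)
Definition incentive_matrix (K : comNzRingType) (X : payoffs K) :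
    'M[K]_(#|{: row_index}|, #|{: profile}|) :=
  \matrix_(r, s) row_form X (enum_val r) (basis_tensor K (enum_val s)).

Definition maximal_minor (K : comNzRingType) (X : payoffs K)
    (f : 'I_#|{: profile}| -> 'I_#|{: row_index}|) : K :=
  \det (rowsub f (incentive_matrix X)).

(* The payoffs as indeterminates, one for each pair (player, profile). *)
Definition indeterminate_payoffs (R : comNzRingType) :
    payoffs {mpoly R[#|{: 'I_n * profile}|]} :=
  fun i => [ffun s => 'X_(enum_rank (i, s))].

Definition generic_game (R : comNzRingType) (X : payoffs R) : Prop :=
  forall f : 'I_#|{: profile}| -> 'I_#|{: row_index}|, injective f ->
    maximal_minor (indeterminate_payoffs R) f != 0 -> maximal_minor X f != 0.

Definition prob_simplex (R : realType) : set (tensor R) :=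
  [set p | (forall s, 0 <= p s) /\ \sum_s p s = 1].

Definition correlated_equilibria (R : realType) (X : payoffs R) :
    set (tensor R) :=
  [set p | prob_simplex p /\
    forall (i : 'I_n) (k l : 'I_(d i)), 0 <= incentive_form X k l (slice p k)].

End Games.

Section Dimension.
Variables (R : fieldType) (V : vectType R).

Definition affine_hull (A : set V) : set V :=
  [set x | exists (m : nat) (c : 'I_m -> R) (v : 'I_m -> V),
    [/\ forall i, A (v i), \sum_i c i = 1 & x = \sum_i c i *: v i]].

Definition has_dimension (A : set V) (m : nat) : Prop :=
  exists (x0 : V) (U : {vspace V}),
    affine_hull A = [set x | x - x0 \in U] /\ \dim U = m.

End Dimension.

Definition full_dimensional (n : nat) (d : 'I_n -> nat) (R : realType)
    (P : set (tensor d R)) : Prop :=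
  has_dimension P (\prod_(i < n) d i - 1)%N.

(* Main.v *)
(* By Farkas' lemma there are weights y >= 0 on the rows of A_G with y A_G = 0
   which are positive exactly on the constraints tight on all of P_G; if there
   are none, P_G is full-dimensional.  Genericity says that every set of rows of
   A_G has the largest rank it can have for any payoffs.  To first order this
   gives y A_G(Y) p = 0 for all payoffs Y and all p satisfying the tight
   constraints.  For Y an indicator it says that, for each player i, y is the rate
   matrix of a Markov chain on the strategies of i for which p, as a function of
   the strategy of i alone, is stationary.

   Let p0 be in the relative interior of P_G.  Pairing y A_G = 0 with the product
   of the marginals of p0 shows that p0 > 0.  Group the strategies of each player
   into the classes of his chain.  Since stationary measures are unique on a class,
   p / p0 depends on the classes only, and the slices of p0 along a class are
   proportional.  Hence, for r invariant under the moves of i within a class c, the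
   tight constraints of i on p0 * r amount to |c| - 1 equations.  Comparing the
   number of these equations with the number of unknowns in a perturbation r by
   terms moved by one player at a time shows first that p0 * r is tight for every
   class function r, and then that if player i has a class with two elements, every
   other player has a single class.  Then all ratios p / p0 are constant. *)
From HB Require Import structures.
Require Import Defs.
From mathcomp Require Import all_boot all_order all_algebra.
From mathcomp Require Import boolp classical_sets reals.
From mathcomp Require Import mpoly ring.

Set Implicit Arguments.
Unset Strict Implicit.
Unset Printing Implicit Defensive.

Import Order.TTheory GRing.Theory Num.Theory.
Local Open Scope ring_scope.

(** * Linear inequalities and generic rank *)

Section LinearAlgebra.
Variable R : realFieldType.

(* Induction on the number of rows (Bartl).  If the first row a cannot be dropped,
   some u satisfies the other constraints and a u = -1; the projection along u
   onto the kernel of a then eliminates a. *)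
Lemma farkas m n (A : 'M[R]_(m, n)) (b : 'rV_n) :
  (forall x : 'cV_n, (forall i, 0 <= (A *m x) i 0) -> 0 <= (b *m x) 0 0) ->
  exists2 y : 'rV_m, forall i, 0 <= y 0 i & b = y *m A.
Proof.
elim: m A b => [|m IHm] A b Ab.
  exists 0; first by case.
  have b_ge0 (x : 'cV_n) : 0 <= (b *m x) 0 0 by apply: Ab => -[].
  rewrite mul0mx; apply/rowP => j; rewrite mxE; apply/le_anti/andP; split.
    by have := b_ge0 (- delta_mx j 0); rewrite mulmxN -colE !mxE oppr_ge0.
  by have := b_ge0 (delta_mx j 0); rewrite -colE !mxE.
rewrite -[m.+1]/(1 + m)%N in A Ab *.
set a := usubmx A; set A' := dsubmx A.
have AE : A = col_mx a A' by rewrite vsubmxK.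
have rowA x : (forall i, 0 <= (A *m x) i 0) <->
    0 <= (a *m x) 0 0 /\ forall i, 0 <= (A' *m x) i 0.
  rewrite AE mul_col_mx; split=> [H | [H0 H1] i].
    by split=> [|i]; [have := H (lshift _ 0) | have := H (rshift _ i)];
      rewrite ?col_mxEu ?col_mxEd.
  by rewrite -[i]splitK; case: (split i) => j /=; rewrite ?ord1 ?col_mxEu ?col_mxEd.
have [A'b|/existsNP[v /not_implyP[A'v /negP]]] :=
  pselect (forall x : 'cV_n, (forall i, 0 <= (A' *m x) i 0) -> 0 <= (b *m x) 0 0).
  have [y y_ge0 ->] := IHm A' b A'b.
  exists (row_mx 0 y) => [i|].
    by rewrite -[i]splitK; case: (split i) => j /=; rewrite ?row_mxEl ?row_mxEr ?mxE.
  by rewrite AE mul_row_col mul0mx add0r.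
rewrite -ltNge => bv_lt0.
have av_lt0 : (a *m v) 0 0 < 0.
  by rewrite ltNge; apply/negP => av; move: bv_lt0; rewrite ltNge Ab //; apply/rowA.
pose u := (- (a *m v) 0 0)^-1 *: v.
have au : a *m u = - 1%:M.
  apply/matrixP => i j; rewrite !ord1 -scalemxAr mxE [RHS]mxE [X in _ = - X]mxE eqxx.
  by rewrite invrN mulNr mulVf // lt_eqF.
have c_gt0 : 0 < (- (a *m v) 0 0)^-1 by rewrite invr_gt0 oppr_gt0.
have A'u i : 0 <= (A' *m u) i 0.
  by rewrite -scalemxAr mxE mulr_ge0 // ltW.
have bu : (b *m u) 0 0 <= 0.
  by rewrite -scalemxAr mxE mulr_ge0_le0 ?ltW.
have [x|y y_ge0 by'] := IHm (A' + A' *m u *m a) (b + b *m u *m a).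
  (* Since [a u = -1], the point [x + u (a x)] lies in the kernel of [a], so the constraint [a]
     holds there with equality. *)
  move=> Hx; have := Ab (x + u *m (a *m x)).
  have -> : b *m (x + u *m (a *m x)) = (b + b *m u *m a) *m x.
    by rewrite mulmxDr mulmxDl !mulmxA.
  apply; apply/rowA; split=> [|i].
    by rewrite mulmxDr !mulmxA au mulNmx mul1mx mulNmx subrr mxE.
    by have := Hx i; rewrite mulmxDl mulmxDr !mulmxA.
(* Solving [by'] for [b] gives [b = y A' + (y A' u - b u) a]; the weight of [a] is nonnegative
   because [A' u >= 0] and [b u <= 0]. *)
exists (row_mx (y *m A' *m u - b *m u) y) => [i|].
  rewrite -[i]splitK; case: (split i) => j /=; rewrite ?row_mxEl ?row_mxEr //.
  rewrite ord1 [X in 0 <= X]mxE [X in _ + X]mxE subr_ge0 (le_trans bu) //.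
  rewrite -mulmxA mxE; apply: sumr_ge0 => k _; exact: mulr_ge0.
have {1}-> : b = y *m (A' + A' *m u *m a) - b *m u *m a by rewrite -by' addrK.
by rewrite AE mul_row_col mulmxBl mulmxDr !mulmxA addrAC addrC addrA addrAC addrC.
Qed.

(** If row [i] vanishes on the cone, [farkas] writes minus this row as a nonnegative combination of
    rows, which is a relation with positive weight at [i]. Summing these relations over [i] makes
    all such weights positive at once. *)
Lemma strict_complementarity m n (A : 'M[R]_(m, n)) :
  exists2 y : 'rV_m, y *m A = 0 & forall i, 0 <= y 0 i /\
    (0 < y 0 i <-> forall x : 'cV_n, (forall j, 0 <= (A *m x) j 0) -> (A *m x) i 0 = 0).
Proof.
pose implied i := forall x : 'cV_n, (forall j, 0 <= (A *m x) j 0) -> (A *m x) i 0 = 0.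
have /choice[z zP] : forall i, exists z : 'rV[R]_m,
    [/\ z *m A = 0, forall j, 0 <= z 0 j & implied i -> 0 < z 0 i].
  move=> i; have [Ii|nIi] := pselect (implied i); last first.
    by exists 0; split=> // [|j]; rewrite ?mul0mx ?mxE.
  have [x Ax|y y_ge0 yA] := @farkas _ _ A (- row i A).
    by rewrite mulNmx -row_mul mxE [X in - X]mxE Ii ?oppr0.
  exists (y + delta_mx 0 i); split=> [|j|_].
  - by rewrite mulmxDl -yA -rowE addNr.
  - by rewrite !mxE addr_ge0 // ler0n.
  - by rewrite !mxE !eqxx ltr_wpDl.
have sum_ge0 i : 0 <= (\sum_j z j) 0 i.
  by rewrite summxE; apply: sumr_ge0 => j _; have [] := zP j.
have sumA : (\sum_j z j) *m A = 0.
  by rewrite mulmx_suml big1 // => i _; have [] := zP i.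
exists (\sum_j z j) => // i; split=> //; split=> [y_gt0 x Ax|].
  have : ((\sum_j z j) *m (A *m x)) 0 0 = 0 by rewrite mulmxA sumA mul0mx mxE.
  rewrite mxE => /eqP; rewrite psumr_eq0 => [/allP/(_ i)|j _]; last exact: mulr_ge0.
  by rewrite mem_index_enum /= mulf_eq0 gt_eqF //= => /(_ isT)/eqP.
move=> /[dup] Ii; have [_ _ /[apply]] := zP i => zi.
rewrite summxE (bigD1 i) //= ltr_pwDl // sumr_ge0 // => j _.
by have [] := zP j.
Qed.

(** With [u = t^-1], the determinant is [t^n] times the characteristic polynomial of [- E] at [u],
    which has finitely many roots; the factor ['X] keeps [u] nonzero. *)
Lemma det_1addZ_neq0 n (E : 'M[R]_n) : exists2 t : R, t != 0 & \det (1%:M + t *: E) != 0.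
Proof.
pose q := char_poly (- E) * 'X.
have q_neq0 : q != 0 by rewrite monic_neq0 // monicMr ?char_poly_monic ?monicX.
have [u] : exists u : R, ~~ root q u.
  have : ~~ all (root q) [seq k%:R | k <- iota 0 (size q)].
    apply/negP => /(max_poly_roots q_neq0); rewrite size_map size_iota ltnn.
    rewrite map_inj_uniq ?iota_uniq => [/(_ isT)//|].
    by apply: mulrIn; rewrite oner_eq0.
  by case/allPn => u _ ?; exists u.
rewrite rootM rootX negb_or => /andP[charu u_neq0].
exists u^-1; first by rewrite invr_eq0.
have -> : 1%:M + u^-1 *: E = u^-1 *: (u%:M + E).
  by rewrite scalerDr scale_scalar_mx mulVf.
rewrite detZ mulf_neq0 ?expf_neq0 ?invr_eq0 //.
move: charu; rewrite rootE /char_poly -horner_evalE -det_map_mx.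
congr (\det _ != 0); apply/matrixP => i j.
by rewrite !mxE /= horner_evalE !hornerE opprK hornerMn hornerX.
Qed.

(* If y E x != 0, some row a of A in the support of y depends on a basis B of these
   rows, while along A + t E it leaves the span of B to first order in t: the
   defect pairs to a nonzero multiple of t with x, which B annihilates.  So the
   rank of these rows jumps for small t != 0. *)
Lemma rank_first_order m n (A E : 'M[R]_(m, n)) (y : 'rV_m) (x : 'cV_n) :
  (forall k (f : 'I_k -> 'I_m) t,
    row_free (rowsub f (A + t *: E)) -> row_free (rowsub f A)) ->
  y *m A = 0 -> (forall i, y 0 i != 0 -> (A *m x) i 0 = 0) -> y *m E *m x = 0.
Proof.
move=> free_spec yA Ax.
pose J := [pred i | y 0 i != 0].
pose g : 'I_#|J| -> 'I_m := @enum_val _ J.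
have sumJ k (M : 'M_(m, k)) : colsub g y *m rowsub g M = y *m M.
  apply/matrixP => i j; rewrite !mxE [RHS](bigID J) /= [X in _ + X]big1 ?addr0.
    rewrite [RHS](big_enum_val (fun k => y i k * M k j)) /=.
    by apply: eq_bigr => l _; rewrite !mxE.
  by move=> l; rewrite !ord1 negbK => /eqP ->; rewrite mul0r.
set AJ := rowsub g A; pose h := maxrankfun AJ; set B := rowsub h AJ.
have Bfree : row_free B by exact: maxrowsub_free.
have /submxP[C AJE] : (AJ <= B)%MS by rewrite eq_maxrowsub.
have yC : colsub g y *m C = 0.
  by apply/eqP; rewrite -(mulmx_free_eq0 _ Bfree) -mulmxA -AJE sumJ yA.
pose F := rowsub h (rowsub g E).
have Bx : B *m x = 0.
  apply/matrixP => i j; rewrite ord1 /B /AJ !mul_rowsub_mx mxE mxE Ax ?mxE //.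
  by have := enum_valP (h i); rewrite inE.
suff Ex : rowsub g E *m x = C *m F *m x.
  by rewrite -sumJ -mulmxA Ex !mulmxA yC !mul0mx.
apply/row_matrixP => e; rewrite !row_mul.
set c := row e C; apply/eqP; rewrite -subr_eq0 -mulmxBl; apply/negP => wx.
set w := row e _ - _ in wx.
have wx' : (w *m x) 0 0 != 0.
  by apply: contra_notN wx => /eqP w0; apply/eqP/matrixP => i j; rewrite !ord1 w0 mxE.
have Bw : row_free (col_mx B w).
  apply: inj_row_free => v; rewrite -[v]hsubmxK mul_row_col => v0.
  have vr : rsubmx v = 0.
    have /matrixP/(_ 0 0) : (lsubmx v *m B + rsubmx v *m w) *m x = 0 by rewrite v0 mul0mx.
    rewrite mulmxDl -!mulmxA Bx mulmx0 add0r mxE big_ord1 [RHS]mxE => /eqP.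
    rewrite mulf_eq0 (negPf wx') orbF => /eqP r0.
    by apply/matrixP => i j; rewrite !ord1 r0 mxE.
  move: v0; rewrite vr mul0mx addr0 => /eqP; rewrite mulmx_free_eq0 // => /eqP ->.
  exact: row_mx0.
have [N BwN] := row_freeP Bw.
have [t t_neq0 dt] := det_1addZ_neq0 (col_mx F 0 *m N).
pose f (i : 'I_(\rank AJ + 1)) := match split i with inl a => g (h a) | inr _ => g e end.
have fE (M : 'M_(m, n)) : rowsub f M = col_mx (rowsub h (rowsub g M)) (row e (rowsub g M)).
  apply/matrixP => i j; rewrite mxE /f -[i]splitK; case: (split i) => a /=.
    by rewrite (unsplitK (inl _)) col_mxEu !mxE.
  by rewrite (unsplitK (inr _)) col_mxEd !mxE.
have rowAJ : row e AJ = c *m B by rewrite /c -row_mul -AJE.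
have : row_free (rowsub f A).
  apply: (free_spec _ f t); apply: inj_row_free => v.
  rewrite fE -[v]hsubmxK mul_row_col; set v1 := lsubmx v; set v2 := rsubmx v.
  have -> : rowsub h (rowsub g (A + t *: E)) = B + t *: F.
    by apply/matrixP => i j; rewrite !mxE.
  have -> : row e (rowsub g (A + t *: E)) = c *m B + t *: row e (rowsub g E).
    by rewrite -rowAJ; apply/matrixP => i j; rewrite !mxE.
  move=> v0.
  (* The row [e] of the perturbation is [w + c F], so the relation [v0] regroups as
     [(v1 + v2 c) (B + t F) + t v2 w = 0]. Multiplied by the right inverse [N], the matrix on the
     right becomes the one that [dt] makes invertible. *)
  have : row_mx (v1 + v2 *m c) (t *: v2) *m (col_mx B w + t *: col_mx F 0) = 0.
    rewrite scale_col_mx add_col_mx scaler0 addr0 mul_row_col -[RHS]v0.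
    rewrite mulmxDl -addrA; congr (_ + _).
    rewrite -scalemxAl scalemxAr -mulmxA -mulmxDr; congr (_ *m _).
    by rewrite mulmxDr scalerBr -scalemxAr -addrA; congr (_ + _); rewrite addrC subrK.
  move/(congr1 (mulmx^~ N)) => /=; rewrite mul0mx -mulmxA mulmxDl BwN -scalemxAl => /eqP.
  rewrite mulmx_free_eq0 ?row_free_unit ?unitmxE ?unitfE // -row_mx0 => /eqP/eq_row_mx[].
  move=> v12 /eqP; rewrite scaler_eq0 (negPf t_neq0) => /eqP v20.
  by move: v12; rewrite v20 mul0mx addr0 => ->.
rewrite fE => /(mulmx_free_eq0 (row_mx (- c) 1%:M)).
rewrite mul_row_col mul1mx rowAJ mulNmx addNr eqxx => /esym; rewrite -row_mx0.
by move=> /eqP/eq_row_mx[_ /matrixP/(_ 0 0)/eqP]; rewrite !mxE oner_eq0.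
Qed.
End LinearAlgebra.

(** * The matrix of a game *)

Section Profiles.
Variables (n : nat) (d : 'I_n -> nat).
Implicit Types s t : profile d.

Definition update s (i : 'I_n) (k : 'I_(d i)) : profile d := [ffun j => dfwith s k j].

Lemma update_in s i (k : 'I_(d i)) : update s k i = k.
Proof. by rewrite ffunE dfwith_in. Qed.

Lemma update_out s i (k : 'I_(d i)) j : i != j -> update s k j = s j.
Proof. by move=> ij; rewrite ffunE dfwith_out. Qed.

Lemma update_eq s t i (k : 'I_(d i)) :
  t i = k -> (forall j, i != j -> t j = s j) -> update s k = t.
Proof.
move=> ti tj; apply/ffunP => j; have [<-|ij] := eqVneq i j; first by rewrite update_in ti.
by rewrite update_out // tj.
Qed.

Lemma update_same s i : update s (s i) = s.
Proof. exact: update_eq. Qed.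

Lemma update_update s i (k l : 'I_(d i)) : update (update s k) l = update s l.
Proof.
by apply: update_eq => [|j ij]; rewrite ?update_in ?update_out.
Qed.

Lemma insert_strategy_in i (k : 'I_(d i)) (j : opp_profile d i) :
  insert_strategy k j i = k.
Proof.
rewrite ffunE; case: (eqVneq i i) => [e|ne]; last by case/eqP: (ne).
by rewrite (eq_irrelevance e (erefl i)).
Qed.

Lemma insert_strategy_out i (k : 'I_(d i)) (j : opp_profile d i) (u : {i' | i' != i}) :
  insert_strategy k j (val u) = j u.
Proof.
case: u => i' i'i; rewrite ffunE /=; case: (eqVneq i' i) => [e|ne]; first by case/eqP: (i'i).
by rewrite (bool_irrelevance ne i'i).
Qed.

Lemma update_insert_strategy i (k l : 'I_(d i)) (j : opp_profile d i) :
  update (insert_strategy k j) l = insert_strategy l j.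
Proof.
apply: update_eq => [|i' i'i]; first exact: insert_strategy_in.
rewrite eq_sym in i'i; pose u : {i' | i' != i} := exist _ i' i'i.
by rewrite -[i']/(val u) !insert_strategy_out.
Qed.

Lemma sum_insert_strategy (V : nmodType) i (k : 'I_(d i)) (F : profile d -> V) :
  \sum_(j : opp_profile d i) F (insert_strategy k j) = \sum_(s : profile d | s i == k) F s.
Proof.
rewrite [RHS](reindex_onto (@insert_strategy _ _ i k)
  (fun s => [ffun u : {i' | i' != i} => s (val u)] : opp_profile d i)) /=.
  apply: eq_bigl => j; rewrite insert_strategy_in eqxx /=; apply/esym/eqP/ffunP => u.
  by rewrite ffunE insert_strategy_out.
move=> s /eqP <-; apply/ffunP => i'; have [->|i'i] := eqVneq i' i.
  exact: insert_strategy_in.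
by rewrite -[i']/(val (exist (fun i' => i' != i) i' i'i)) insert_strategy_out ffunE.
Qed.

(* The payoffs are plain functions here, so that all sums are taken in [K] and
   not in [K^o]. *)
Definition gain (K : comNzRingType) (X : 'I_n -> profile d -> K) i (k l : 'I_(d i))
    (p : profile d -> K) : K :=
  \sum_(s : profile d | s i == k) (X i s - X i (update s l)) * p s.

Lemma incentive_form_slice (K : comNzRingType) (X : payoffs d K) i (k l : 'I_(d i)) p :
  incentive_form X k l (slice p k) = gain (K := K) (fun i => X i) k l p.
Proof.
rewrite /gain -sum_insert_strategy; apply: eq_bigr => j _.
by rewrite ffunE update_insert_strategy.
Qed.

Lemma row_form_basis (K : comNzRingType) (X : payoffs d K) r (p : tensor d K) :
  row_form X r p = \sum_s row_form X r (basis_tensor K s) * (p s : K).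
Proof.
case: r => [u|t] /=; last first.
  rewrite (bigD1 t) //= ffunE eqxx mul1r big1 ?addr0 // => s /negPf st.
  by rewrite ffunE eq_sym st mul0r.
under eq_bigr do rewrite incentive_form_slice /gain mulr_suml.
rewrite incentive_form_slice /gain [RHS]exchange_big /=; apply: eq_bigr => t _.
rewrite (bigD1 t) //= ffunE eqxx mulr1 big1 ?addr0 // => s /negPf st.
by rewrite ffunE eq_sym st mulr0 mul0r.
Qed.

Definition tensor_col (K : comNzRingType) (p : tensor d K) : 'cV[K]_#|{: profile d}| :=
  \col_s p (enum_val s).

Lemma incentive_matrix_mul (K : comNzRingType) (X : payoffs d K) p r :
  (incentive_matrix X *m tensor_col p) r 0 = row_form X (enum_val r) p.
Proof.
rewrite mxE row_form_basis [RHS](reindex _ (onW_bij _ (@enum_val_bij _))) /=.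
by apply: eq_bigr => s _; rewrite !mxE.
Qed.

Lemma maximal_minor_morph (K L : comNzRingType) (phi : {rmorphism K -> L})
    (X : payoffs d K) f :
  phi (maximal_minor X f) = maximal_minor (fun i => [ffun s => phi (X i s)]) f.
Proof.
rewrite /maximal_minor -det_map_mx; congr (\det _); apply/matrixP => i j.
rewrite !mxE; case: (enum_val _) => [u|s] /=; last by rewrite !ffunE rmorph_nat.
rewrite !incentive_form_slice rmorph_sum; apply: eq_bigr => s _.
by rewrite !ffunE rmorphM rmorphB rmorph_nat.
Qed.

(** Evaluation at [Y] sends the minor in the indeterminates to the minor at [Y], so the former is a
    nonzero polynomial. A repeated row would make the minor at [Y] vanish, so [f] is injective. *)
Lemma generic_minor (R : comNzRingType) (X : payoffs d R) (Y : payoffs d R) f :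
  generic_game X -> maximal_minor Y f != 0 -> maximal_minor X f != 0.
Proof.
move=> genX Yf; apply: genX => [i j fij|].
  apply/eqP; apply: contraNT Yf => ij; apply/eqP.
  by apply: (determinant_alternate ij) => k; rewrite !mxE fij.
apply: contraNneq Yf => f0.
pose v (x : 'I_#|{: 'I_n * profile d}|) := Y (enum_val x).1 (enum_val x).2.
have := congr1 (meval v) f0; rewrite meval0 maximal_minor_morph => <-.
apply/eqP; congr (maximal_minor _ f); apply/funext => i; apply/ffunP => s.
by rewrite !ffunE /= mevalXU /v enum_rankK.
Qed.

(* An independent set of rows extends to a basis by coordinate rows, so the
   condition on maximal minors controls all smaller sets of rows. *)
Lemma generic_row_free (R : fieldType) (X Y : payoffs d R) k
    (f : 'I_k -> 'I_#|{: row_index d}|) : generic_game X ->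
  row_free (rowsub f (incentive_matrix Y)) -> row_free (rowsub f (incentive_matrix X)).
Proof.
move=> genX.
have [m] := ubnP (#|{: profile d}| - k); elim: m => // m IHm in k f *.
rewrite ltnS => km freeY.
have := rank_leq_col (rowsub f (incentive_matrix Y)); rewrite (eqP freeY).
rewrite leq_eqVlt => /predU1P[kD|kD].
  move: f freeY {km}; rewrite kD => f.
  by rewrite !row_free_unit !unitmxE !unitfE; exact: (generic_minor genX).
(* Fewer rows than profiles cannot span every coordinate form. The row of a coordinate form is the
   same for all payoffs, so it extends the families for [X] and [Y] alike. *)
have [s sY] : exists s : 'I_#|{: profile d}|,
    ~~ ((delta_mx 0 s : 'rV_#|{: profile d}|) <= rowsub f (incentive_matrix Y))%MS.
  apply/existsP; rewrite -negb_forall; apply: contraL kD => /forallP sY.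
  rewrite -leqNgt -[X in (_ <= X)%N](eqP freeY) -[X in (X <= _)%N](mxrank1 R).
  by apply: mxrankS; apply/row_subP => i; rewrite rowE mulmx1.
pose r : 'I_#|{: row_index d}| := enum_rank (inr (enum_val s) : row_index d).
have rowr (Z : payoffs d R) : row r (incentive_matrix Z) = delta_mx 0 s.
  apply/rowP => j; rewrite !mxE enum_rankK /= ffunE (inj_eq enum_val_inj).
  by rewrite eq_sym.
pose f' (i : 'I_(k + 1)) := match split i with inl a => f a | inr _ => r end.
have f'E (Z : payoffs d R) : rowsub f' (incentive_matrix Z) =
    col_mx (rowsub f (incentive_matrix Z)) (delta_mx 0 s).
  apply/matrixP => i j; rewrite mxE /f' -[i]splitK; case: (split i) => a /=.
    by rewrite (unsplitK (inl _)) col_mxEu !mxE.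
  by rewrite (unsplitK (inr _)) col_mxEd -(rowr Z) !mxE.
have : row_free (rowsub f' (incentive_matrix X)).
  apply: IHm; first by rewrite addn1 subnS prednK ?subn_gt0 // in km *.
  rewrite f'E; apply: inj_row_free => v; rewrite -[v]hsubmxK mul_row_col.
  have [-> | v2] := eqVneq (rsubmx v) 0.
    rewrite mul0mx addr0 => /eqP; rewrite mulmx_free_eq0 // => /eqP ->.
    exact: row_mx0.
  rewrite [rsubmx v]mx11_scalar mul_scalar_mx => /eqP; rewrite addrC addr_eq0 => /eqP vE.
  case/negP: sY; have c0 : rsubmx v 0 0 != 0.
    apply: contraNneq v2 => c0; apply/eqP/matrixP => i j.
    by rewrite !ord1 [LHS]c0 mxE.
  rewrite -(scalerK c0 (delta_mx 0 s)) vE scalerN -scaleNr scalemx_sub //.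
  exact: submxMl.
rewrite f'E => freeX; apply: inj_row_free => v v0.
have := mulmx_free_eq0 (row_mx v 0) freeX.
rewrite mul_row_col v0 mul0mx addr0 eqxx => /esym.
by rewrite -row_mx0 => /eqP/eq_row_mx[].
Qed.

End Profiles.

(** * Stationarity *)

(* The Dirichlet energy of g / f vanishes. *)
Lemma stationary_ratio (R : realFieldType) (T : finType) (c : T -> T -> R) (f g : T -> R) :
  (forall k l, 0 <= c k l) -> (forall k, 0 < f k) ->
  (forall k, \sum_l c k l * f k = \sum_l c l k * f l) ->
  (forall k, \sum_l c k l * g k = \sum_l c l k * g l) ->
  forall k l, c k l != 0 -> g k * f l = g l * f k.
Proof.
move=> c_ge0 f_gt0 cf cg k l ckl.
pose r k := g k / f k; have gE k' : g k' = r k' * f k'.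
  by rewrite /r divfK // gt_eqF.
pose S := \sum_k \sum_l c k l * f k * r k ^+ 2.
have term_ge0 a b : 0 <= c b a * f b * (r b - r a) ^+ 2.
  by apply: mulr_ge0; rewrite ?sqr_ge0 ?mulr_ge0 // ltW.
have : \sum_a \sum_b c b a * f b * (r b - r a) ^+ 2 = 0.
  (* Expanding the square, the cross term is computed from the stationarity of [g], and the term in
     [r a ^+ 2] from that of [f]. *)
  transitivity (S - 2 * S + S); last by ring.
  have S1 : \sum_a \sum_b c b a * f b * r b ^+ 2 = S by rewrite exchange_big.
  have S2 : \sum_a \sum_b c b a * f b * r b * r a = S.
    apply: eq_bigr => a _; rewrite -mulr_suml.
    under eq_bigr do rewrite -mulrA [f _ * _]mulrC -gE.
    by rewrite -cg mulr_suml; apply: eq_bigr => b _; rewrite gE; ring.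
  have S3 : \sum_a \sum_b c b a * f b * r a ^+ 2 = S.
    by apply: eq_bigr => a _; rewrite -mulr_suml -cf mulr_suml.
  rewrite -{1}S1 -{1}S2 -{1}S3 mulr_sumr -sumrB -big_split; apply: eq_bigr => a _ /=.
  rewrite mulr_sumr -sumrB -big_split; apply: eq_bigr => b _ /=; ring.
move/eqP; rewrite psumr_eq0 => [/allP/(_ l (mem_index_enum _))|a _]; last exact: sumr_ge0.
rewrite /= psumr_eq0 => [/allP/(_ k (mem_index_enum _))/=|//].
rewrite !mulf_eq0 (negPf ckl) gt_eqF //= orbb subr_eq0 => /eqP rkl.
by rewrite !gE rkl; ring.
Qed.

Section Balance.
Variables (n : nat) (d : 'I_n -> nat) (R : realFieldType).
Implicit Types (X Y : payoffs d R) (p q : tensor d R).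

Lemma sum_update (V : nmodType) i (k l : 'I_(d i)) (F : profile d -> V) :
  \sum_(s : profile d | s i == k) F s = \sum_(s : profile d | s i == l) F (update s k).
Proof.
rewrite (reindex_onto (fun s => update s k) (fun s => update s l)) /=.
  apply: eq_bigl => s; rewrite update_in eqxx update_update /=.
  by apply/eqP/eqP => [<-|<-]; rewrite ?update_in ?update_same.
by move=> s /eqP <-; rewrite update_update update_same.
Qed.

Definition balanced i (c : 'I_(d i) -> 'I_(d i) -> R) (p : profile d -> R) :=
  forall s : profile d, \sum_l c (s i) l * p s = \sum_l c l (s i) * p (update s l).

(** The coefficient of [X i s] in the sum is the flow out of [s] minus the flow into [s]. *)
Lemma balanced_gain (X : 'I_n -> profile d -> R) i c (p : profile d -> R) :
  @balanced i c p -> \sum_k \sum_l c k l * gain X k l p = 0.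
Proof.
move=> cp; rewrite /gain.
under eq_bigr => k _ do under eq_bigr => l _ do
  (under eq_bigr => s _ do rewrite mulrBl; rewrite sumrB mulrBr !mulr_sumr).
under eq_bigr => k _ do rewrite sumrB.
rewrite sumrB; apply/eqP; rewrite subr_eq0; apply/eqP.
transitivity (\sum_k \sum_(s : profile d | s i == k) X i s * \sum_l c (s i) l * p s).
  apply: eq_bigr => k _; rewrite exchange_big /=; apply: eq_bigr => s /eqP sk.
  by rewrite mulr_sumr sk; apply: eq_bigr => l _; rewrite mulrCA.
rewrite [RHS]exchange_big /=; apply: eq_bigr => l _.
under [RHS]eq_bigr => k _ do rewrite (sum_update k l).
rewrite [RHS]exchange_big /=; apply: eq_bigr => s /eqP sl.
rewrite cp mulr_sumr; apply: eq_bigr => k _.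
by rewrite update_update -sl update_same mulrCA.
Qed.

(** The payoffs that are the indicator of one player and one profile isolate a single balance
    equation. *)
Lemma balanced_of_gain (c : forall i, 'I_(d i) -> 'I_(d i) -> R) (p : profile d -> R) :
  (forall X : payoffs d R, \sum_i \sum_k \sum_l c i k l * gain (K := R) (fun i => X i) k l p = 0) ->
  forall i, balanced (c i) p.
Proof.
move=> H i s; pose Y : payoffs d R := fun i' => [ffun s' => ((i' == i) && (s' == s))%:R].
have := H Y; rewrite (bigD1 i) //= [X in _ + X]big1 ?addr0 => [|j /negPf ji]; last first.
  rewrite big1 // => k _; rewrite big1 // => l _; rewrite /gain big1 ?mulr0 // => t _.
  by rewrite !ffunE ji subrr mul0r.
have gainY (k l : 'I_(d i)) : gain (K := R) (fun i => Y i) k l p =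
    (s i == k)%:R * p s - (s i == l)%:R * p (update s k).
  rewrite /gain; under eq_bigr do rewrite !ffunE eqxx /= mulrBl.
  rewrite sumrB; congr (_ - _).
    rewrite big_mkcond (bigD1 s) //= eqxx big1 ?addr0 => [|t /negPf ->].
      by case: ifP; rewrite ?mul1r ?mul0r.
    by rewrite mul0r if_same.
  rewrite big_mkcond (bigD1 (update s k)) //= update_in eqxx update_update.
  rewrite big1 ?addr0 => [|t ts].
    congr (_%:R * _); congr nat_of_bool; apply/eqP/eqP => [<-|<-].
      by rewrite update_in.
    exact: update_same.
  case: eqP => // tk; case: eqP => [ts'|]; last by rewrite mul0r.
  by move: ts; rewrite -ts' update_update -tk update_same eqxx.
under eq_bigr => k _ do under eq_bigr => l _ do rewrite gainY mulrBr.
under eq_bigr => k _ do rewrite sumrB.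
rewrite sumrB => /eqP; rewrite subr_eq0 => /eqP.
rewrite (bigD1 (s i)) //= [X in _ + X]big1 ?addr0; last first.
  by move=> k /negPf ks; rewrite big1 // => l _; rewrite eq_sym ks mul0r mulr0.
under eq_bigr do rewrite eqxx mul1r.
move=> ->; apply: eq_bigr => k _; rewrite (bigD1 (s i)) //= eqxx mul1r big1 ?addr0 // => l /negPf ls.
by rewrite eq_sym ls mul0r mulr0.
Qed.

(** The weights on deviations become transition rates on all pairs; the diagonal, which has no row,
    gets 0. *)
Definition rate (y : row_index d -> R) i (k l : 'I_(d i)) : R :=
  if insub (Tagged (fun i => ('I_(d i) * 'I_(d i))%type) (k, l)) is Some u
  then y (inl u) else 0.

Lemma rate_diag y i (k : 'I_(d i)) : rate y k k = 0.
Proof. by rewrite /rate insubN //= eqxx. Qed.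

Lemma rateE y i (k l : 'I_(d i)) : k != l ->
  exists2 u : deviation d, rate y k l = y (inl u) &
    forall (X : payoffs d R) p, row_form X (inl u) p = gain (K := R) (fun i => X i) k l p.
Proof.
move=> kl; rewrite /rate; case: insubP => [u _ uE|]; last by rewrite /= kl.
by exists u => // X p /=; rewrite uE incentive_form_slice.
Qed.

Lemma sum_deviation (y : row_index d -> R) X p :
  \sum_(u : deviation d) y (inl u) * (row_form X (inl u) p : R) =
  \sum_(i : 'I_n) \sum_k \sum_l rate y (i := i) k l * gain (K := R) (fun i => X i) k l p.
Proof.
pose D := [pred r : {i : 'I_n & ('I_(d i) * 'I_(d i))%type} | (tagged r).1 != (tagged r).2].
pose G (r : {i : 'I_n & ('I_(d i) * 'I_(d i))%type}) :=
  rate y (tagged r).1 (tagged r).2 *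
  gain (K := R) (fun i => X i) (tagged r).1 (tagged r).2 p.
transitivity (\sum_(r in D) G r).
  transitivity (\sum_(u : deviation d) G (val u)); last exact/esym/(big_sub D).
  apply: eq_bigr => u _ /=; rewrite incentive_form_slice /G /rate.
  by case: u => -[i [k l]] kl; rewrite insubT.
rewrite big_mkcond (eq_bigr G) => [|r _]; last first.
  by case: ifP => // /negbFE/eqP; rewrite /G => ->; rewrite rate_diag mul0r.
under [RHS]eq_bigr => i _ do rewrite pair_big /=.
by rewrite sig_big_dep.
Qed.

(** The matrix is affine in the payoffs, and its derivative [E] in a direction [Y] has zero
    coordinate rows. Genericity supplies the rank hypothesis of [rank_first_order], and [Y] is
    arbitrary. *)
Lemma generic_balanced X p (y : row_index d -> R) : generic_game X ->
  (forall q, \sum_r y r * (row_form X r q : R) = 0) ->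
  (forall r, y r != 0 -> row_form X r p = 0) ->
  forall i, balanced (@rate y i) p.
Proof.
move=> genX yX pX; apply: balanced_of_gain => Y; rewrite -sum_deviation.
pose E : 'M[R]_(#|{: row_index d}|, #|{: profile d}|) :=
  \matrix_(r, s) match enum_val r with
                 | inl u => row_form Y (inl u) (basis_tensor R (enum_val s))
                 | inr _ => 0 end.
pose yv : 'rV[R]_#|{: row_index d}| := \row_r y (enum_val r).
have AE (t : R) : incentive_matrix X + t *: E =
    incentive_matrix (fun i => [ffun s => (X i s : R) + t * Y i s] : tensor d R).
  apply/matrixP => r s; rewrite !mxE; case: (enum_val r) => [u|s'] /=; last first.
    by rewrite mulr0 addr0.
  rewrite !incentive_form_slice mulr_sumr -big_split; apply: eq_bigr => s' _ /=.
  by rewrite !ffunE; ring.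
have Ep r : (E *m tensor_col p) r 0 =
    match enum_val r with inl u => row_form Y (inl u) p | inr _ => 0 end.
  rewrite mxE; case rE: (enum_val r) => [u|s].
    rewrite row_form_basis [RHS](reindex _ (onW_bij _ (@enum_val_bij _))).
    by apply: eq_bigr => s _; rewrite !mxE rE.
  by rewrite big1 // => s' _; rewrite !mxE rE mul0r.
have /matrixP/(_ 0 0) : yv *m E *m tensor_col p = 0.
  apply: (@rank_first_order _ _ _ (incentive_matrix X)) => [k f t||r].
  - by rewrite AE; apply: generic_row_free.
  - apply/rowP => s; rewrite mxE [RHS]mxE -[RHS](yX (basis_tensor R (enum_val s))).
    rewrite [RHS](reindex _ (onW_bij _ (@enum_val_bij _))).
    by apply: eq_bigr => r _; rewrite !mxE.
  - by rewrite mxE incentive_matrix_mul; apply: pX.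
rewrite -mulmxA mxE [RHS]mxE => E0; apply: etrans E0.
transitivity (\sum_r y r * match r with inl u => row_form Y (inl u) p | inr _ => 0 end).
  by rewrite big_sumType /= [X in _ + X]big1 ?addr0 // => s _; rewrite mulr0.
rewrite (reindex _ (onW_bij _ (@enum_val_bij _))).
by apply: eq_bigr => r _; rewrite Ep !mxE.
Qed.
End Balance.

(** * Tight tensors *)

Lemma dim_ffun (R : fieldType) (U : finType) : dim {ffun U -> R^o} = #|U|.
Proof. by rewrite /dim /= muln1. Qed.

Lemma kernel_neq0 (R : fieldType) (U E : finType) (L : {ffun U -> R^o} -> E -> R) :
  (forall a x y e, L (a *: x + y) e = a * L x e + L y e) ->
  (#|E| < #|U|)%N -> exists2 x, x != 0 & forall e, L x e = 0.
Proof.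
move=> Llin EU; pose f x : {ffun E -> R^o} := [ffun e => L x e].
have f_linear : linear f.
  by move=> a x y; apply/ffunP => e; rewrite !ffunE Llin.
pose F : {linear {ffun U -> R^o} -> {ffun E -> R^o}} :=
  HB.pack f (GRing.isLinear.Build _ _ _ _ f f_linear).
have kerF : lker (linfun F) != 0%VS.
  rewrite -dimv_eq0 -lt0n -(ltn_add2r (\dim (limg (linfun F)))) add0n.
  have /eqP := limg_ker_dim (linfun F) fullv; rewrite capfv dimvf dim_ffun => /eqP ->.
  by rewrite (leq_ltn_trans _ EU) // -(dim_ffun R E) -dimvf dimvS ?subvf.
exists (vpick (lker (linfun F))); first by rewrite vpick0.
move=> e; have := memv_pick (lker (linfun F)); rewrite memv_ker lfunE /= => /eqP/ffunP/(_ e).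
by rewrite !ffunE.
Qed.

Lemma connect_const (T : finType) (V : Type) (e : rel T) (f : T -> V) :
  (forall k l, e k l -> f k = f l) -> forall k l, connect e k l -> f k = f l.
Proof.
move=> fe k l /connectP[w]; elim: w k => [k _ -> //|m w IHw k /= /andP[km mw] lE].
by rewrite (fe _ _ km); apply: IHw.
Qed.

Section TightSpace.
Variables (n : nat) (d : 'I_n -> nat) (R : realFieldType).
Variables (X : 'I_n -> profile d -> R) (c : forall i, 'I_(d i) -> 'I_(d i) -> R).
Variable p0 : profile d -> R.
Arguments c {i}.

Definition tight (p : profile d -> R) :=
  forall i (k l : 'I_(d i)), c k l != 0 -> gain X k l p = 0.

Hypothesis c_ge0 : forall i (k l : 'I_(d i)), 0 <= c k l.
Hypothesis p0_gt0 : forall s, 0 < p0 s.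
Hypothesis p0_tight : tight p0.
Hypothesis tight_balanced : forall p, tight p -> forall i, balanced (@c i) p.

Let p0_neq0 s : p0 s != 0. Proof. by rewrite gt_eqF. Qed.

(** Directions are forgotten, since [stationary_ratio] carries ratios along an edge either way. The
    classes are the connected components, and [rep] picks one strategy in each. *)
Definition linked i : rel 'I_(d i) := fun k l => (c k l != 0) || (c l k != 0).
Definition rep i (k : 'I_(d i)) : 'I_(d i) := fingraph.root (@linked i) k.

Let linked_sym i : connect_sym (@linked i).
Proof. by apply: sym_connect_sym => k l; rewrite /linked orbC. Qed.

Lemma rep_connect i (k l : 'I_(d i)) : (rep k == rep l) = connect (@linked i) k l.
Proof. exact: (root_connect (@linked_sym i)). Qed.

Lemma rep_idem i (k : 'I_(d i)) : rep (rep k) = rep k.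
Proof. exact: (root_root (@linked_sym i)). Qed.

Lemma rep_rate i (k l : 'I_(d i)) : c k l != 0 -> rep k = rep l.
Proof.
by move=> ckl; apply/eqP; rewrite rep_connect connect1 // /linked ckl.
Qed.

Lemma balanced_update i p s : balanced (@c i) p ->
  forall k : 'I_(d i), \sum_l c k l * p (update s k) = \sum_l c l k * p (update s l).
Proof.
move=> cp k; have := cp (update s k); rewrite update_in => ->.
by apply: eq_bigr => l _; rewrite update_update.
Qed.

(** The two base profiles serve two purposes: [s = t] makes [p / p0] a class function, and [p = p0]
    makes the slices of [p0] along a class proportional. *)
Lemma balanced_ratio i p s t (k l : 'I_(d i)) : balanced (@c i) p -> rep k = rep l ->
  p (update s k) / p0 (update t k) = p (update s l) / p0 (update t l).
Proof.
move=> cp /eqP; rewrite rep_connect; move: k l.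
apply: (connect_const (f := fun k : 'I_(d i) => p (update s k) / p0 (update t k))) => k l kl.
apply/eqP; rewrite eqr_div //; apply/eqP.
have cp0 := tight_balanced p0_tight i.
have E := stationary_ratio (@c_ge0 i) (fun k : 'I_(d i) => p0_gt0 (update t k))
  (balanced_update t cp0) (balanced_update s cp).
by case/orP: kl => /E -> //; rewrite mulrC.
Qed.

Definition class_function (r : profile d -> R) :=
  forall i (s : profile d) (l : 'I_(d i)), rep l = rep (s i) -> r (update s l) = r s.

Lemma class_functionP r (s t : profile d) :
  class_function r -> (forall i, rep (s i) = rep (t i)) -> r s = r t.
Proof.
move=> rcl; have [m] := ubnP #|[set i | s i != t i]|; elim: m => // m IHm in s *.
rewrite ltnS => le_m st; have [i /negPf sti|eq_st] := pickP [pred i | s i != t i]; last first.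
  by congr (r _); apply/ffunP => i; have /negbFE/eqP := eq_st i.
rewrite -(rcl i s (t i)) //; apply: IHm => [|j].
  apply: leq_trans le_m; rewrite [leqRHS](cardsD1 i) inE sti add1n ltnS.
  apply: subset_leq_card; apply/fintype.subsetP => j; rewrite !inE.
  have [->|ij] := eqVneq j i; first by rewrite update_in eqxx.
  by rewrite update_out // eq_sym.
by have [<-|ij] := eqVneq i j; rewrite ?update_in // update_out.
Qed.

Lemma tight_class_function p : tight p -> class_function (fun s => p s / p0 s).
Proof.
move=> /tight_balanced cp i s l ls.
by rewrite (balanced_ratio s s (cp i) ls) update_same.
Qed.

Lemma gain_sum (I : finType) (P : pred I) i (k l : 'I_(d i)) (F : I -> profile d -> R) :
  gain X k l (fun s => \sum_(j | P j) F j s) = \sum_(j | P j) gain X k l (F j).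
Proof. by rewrite /gain exchange_big; apply: eq_bigr => s _; rewrite mulr_sumr. Qed.

Lemma eq_gain i (k l : 'I_(d i)) (p q : profile d -> R) :
  (forall s : profile d, s i = k -> p s = q s) -> gain X k l p = gain X k l q.
Proof. by move=> pq; apply: eq_bigr => s /eqP /pq ->. Qed.

Lemma gainZ i (k l : 'I_(d i)) a (p : profile d -> R) :
  gain X k l (fun s => p s * a) = gain X k l p * a.
Proof. by rewrite /gain mulr_suml; apply: eq_bigr => s _; rewrite mulrA. Qed.

(* Along a class the slices of [p0] are proportional. For [r] invariant along
   the class of [k], [payoff_value k r] is therefore, up to a common factor, the
   payoff of the strategy [k] against the conditional distribution of [p0 * r]. *)
Definition payoff_value i (k : 'I_(d i)) (r : profile d -> R) :=
  \sum_(s : profile d | s i == k) X i s * (p0 (update s (rep k)) * r s).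

(** By proportionality, the ratio of [p0 s] to [p0 (update s (rep k))] is the same for all [s] with
    [s i = k], and comes out of the sum. *)
Lemma gain_payoff_value i (k l : 'I_(d i)) r s0 :
  rep k = rep l -> (forall s : profile d, s i = k -> r (update s l) = r s) ->
  gain X k l (fun s => p0 s * r s) * p0 (update s0 (rep k)) =
  p0 (update s0 k) * (payoff_value k r - payoff_value l r).
Proof.
move=> kl rk; rewrite /payoff_value (sum_update l k) mulr_suml -sumrB mulr_sumr.
apply: eq_bigr => s /eqP sk; rewrite update_update rk // -kl.
have := balanced_ratio s0 s (tight_balanced p0_tight i) (rep_idem k).
have -> : update s k = s by rewrite -sk update_same.
move/eqP; rewrite eqr_div // => /eqP E.
transitivity ((X i s - X i (update s l)) * r s * (p0 (update s0 (rep k)) * p0 s)); first by ring.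
by rewrite E; ring.
Qed.

Definition moved := {e : {i : 'I_n & 'I_(d i)} | rep (tagged e) != tagged e}.

(* Up to the term [beta x (Some i)], tight for player [i] by assumption, the
   perturbation is invariant under the moves of [i] within his classes, which
   leaves one equation for each strategy that is not a representative. *)
Lemma tight_system (U : finType) (beta : {ffun U -> R^o} -> option 'I_n -> profile d -> R) :
  (forall a x y j s, beta (a *: x + y) j s = a * beta x j s + beta y j s) ->
  (forall x j i (s : profile d) (l : 'I_(d i)), Some i != j -> rep l = rep (s i) ->
     beta x j (update s l) = beta x j s) ->
  (forall x i (k l : 'I_(d i)), c k l != 0 ->
     gain X k l (fun s => p0 s * beta x (Some i) s) = 0) ->
  (#|{: moved}| < #|U|)%N ->
  exists2 x, x != 0 & tight (fun s => p0 s * \sum_j beta x j s).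
Proof.
move=> beta_lin beta_inv beta_self ltU.
pose others x i s := \sum_(j | j != Some i) beta x j s.
pose L x (e : moved) := payoff_value (tagged (val e)) (others x (tag (val e))) -
  payoff_value (rep (tagged (val e))) (others x (tag (val e))).
have L_lin a x y e : L (a *: x + y) e = a * L x e + L y e.
  have others_lin i s : others (a *: x + y) i s = a * others x i s + others y i s.
    by rewrite /others mulr_sumr -big_split; apply: eq_bigr => j _; rewrite beta_lin.
  have value_lin i (k : 'I_(d i)) : payoff_value k (others (a *: x + y) i) =
      a * payoff_value k (others x i) + payoff_value k (others y i).
    rewrite /payoff_value mulr_sumr -big_split; apply: eq_bigr => s _ /=.
    by rewrite others_lin; ring.
  by rewrite /L !value_lin; ring.
have [x x_neq0 Lx] := kernel_neq0 L_lin ltU; exists x => //.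
have value_eq i (k : 'I_(d i)) :
    payoff_value k (others x i) = payoff_value (rep k) (others x i).
  have [{1}<- //|kk] := eqVneq (rep k) k.
  by have /eqP := Lx (exist _ (Tagged (fun i => 'I_(d i)) k) kk); rewrite subr_eq0 => /eqP.
move=> i k l ckl; under [fun s => _]funext do rewrite mulr_sumr.
rewrite gain_sum (bigD1 (Some i)) //= beta_self // add0r -gain_sum.
have -> : (fun s => \sum_(j | j != Some i) p0 s * beta x j s) =
    (fun s => p0 s * others x i s) by apply/funext => s; rewrite mulr_sumr.
have [s0 _|no] := pickP (fun s : profile d => s i == k); last by rewrite /gain big_pred0.
have := @gain_payoff_value i k l (others x i) s0 (rep_rate ckl).
rewrite (value_eq _ k) (value_eq _ l) (rep_rate ckl) subrr mulr0.
move=> E; apply: (mulIf (p0_neq0 (update s0 (rep l)))); rewrite mul0r; apply: E => s sk.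
by apply: eq_bigr => j ji; rewrite beta_inv // ?sk ?(rep_rate ckl) // eq_sym.
Qed.

Lemma tight_class_functionM r : tight (fun s => p0 s * r s) -> class_function r.
Proof.
move/tight_class_function; congr class_function.
by apply/funext => s; rewrite mulrC mulKf.
Qed.

(* In the perturbation a q + B_1 + ... + B_n, where B_i depends on the strategy of
   [i] only and vanishes at the representatives, there is one unknown more than
   there are equations; a solution has B = 0, hence a != 0. *)
Lemma class_function_tight q : class_function q -> tight (fun s => p0 s * q s).
Proof.
move=> qcl; have [s0 _|no] := pickP (@predT (profile d)); last first.
  by move=> i k l _; rewrite /gain big1 // => s; have := no s.
pose B (x : {ffun option moved -> R^o}) i (k : 'I_(d i)) : R :=
  if insub (Tagged (fun i => 'I_(d i)) k) is Some e then x (Some e) else 0.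
pose beta x j (s : profile d) := if j is Some i then B x i (s i) else (x None : R) * q s.
have B_rep x i (k : 'I_(d i)) : B x i (rep k) = 0 by rewrite /B insubN //= rep_idem eqxx.
have [a x y [i|] s|x [j|] i s l|x i k l ckl||x x_neq0 xt] := @tight_system _ beta.
- by rewrite /= /B; case: insubP => [e _ _|_]; rewrite ?ffunE // mulr0 addr0.
- by rewrite /= !ffunE mulrDl mulrA.
- by move=> ij _; rewrite /= update_out.
- by move=> _ ls; rewrite /= qcl.
- rewrite (@eq_gain _ _ _ _ (fun s => p0 s * B x i k)) => [|s sk]; last by rewrite /= sk.
  by rewrite gainZ p0_tight // mul0r.
- by rewrite card_option.
(* The solution is a class function, so replacing [k] by [rep k] does not change it; only the term
   of player [i] could change, and it vanishes at [rep k]. *)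
have B0 i k : B x i k = 0.
  have /(_ i (update s0 k) (rep k)) := tight_class_functionM xt.
  rewrite update_in update_update rep_idem => /(_ erefl).
  rewrite (bigD1 (Some i)) // [RHS](bigD1 (Some i)) //= !update_in B_rep add0r => E.
  apply: (addIr (\sum_(j | j != Some i) beta x j (update s0 k))).
  rewrite -E add0r; apply: eq_bigr => -[j|] //= ji; first by rewrite !update_out // eq_sym.
  by rewrite -(qcl i (update s0 k) (rep k)) ?update_update ?update_in ?rep_idem.
have xN : x None != 0.
  apply: contraNneq x_neq0 => xN; apply/eqP/ffunP => -[e|]; rewrite [RHS]ffunE //.
  have := B0 (tag (val e)) (tagged (val e)); by rewrite /B taggedK valK.
move=> i k l ckl; have := xt i k l ckl.
rewrite (@eq_gain _ _ _ _ (fun s => (p0 s * q s) * (x None : R))) => [|s _].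
  by rewrite gainZ => /eqP; rewrite mulf_eq0 (negPf xN) orbF => /eqP.
rewrite (bigD1 None) //= big1 ?addr0 => [|[j|] // _]; last exact: B0.
by ring.
Qed.

Definition representative (s : profile d) : profile d := [ffun i => rep (s i)].

(** Such a pair amounts to a non-representative strategy of one player together with a class for
    every other player. *)
Definition moved_only_at (u : 'I_n * profile d) :=
  (rep (u.2 u.1) != u.2 u.1) && [forall j, (j != u.1) ==> (rep (u.2 j) == u.2 j)].

Definition moved_profile := {u | moved_only_at u}.

Lemma representative_update (s : profile d) i (k : 'I_(d i)) :
  rep k = rep (s i) -> representative (update s k) = representative s.
Proof.
move=> ks; apply/ffunP => j; rewrite !ffunE; have [<-|ij] := eqVneq i j.
  by rewrite dfwith_in.
by rewrite dfwith_out.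
Qed.

Lemma representative_idem (s : profile d) : representative (representative s) = representative s.
Proof. by apply/ffunP => j; rewrite !ffunE rep_idem. Qed.

(* The unknowns: for each product of classes separately, a perturbation in the
   strategy of one player, normalized to vanish at the representatives. *)
Lemma card_moved_profile : (#|{: moved_profile}| <= #|{: moved}|)%N.
Proof.
rewrite leqNgt; apply/negP => lt_moved.
pose b (x : {ffun moved_profile -> R^o}) i (s : profile d) : R :=
  if insub (i, s) is Some u then x u else 0.
pose beta x j (s : profile d) :=
  if j is Some i then b x i (update (representative s) (s i)) else 0.
have [a x y [i|] s|x [j|] i s l|x i k l ckl||x x_neq0 xt] := @tight_system _ beta.
- by rewrite /= /b; case: insubP => [e _ _|_]; rewrite ?ffunE // mulr0 addr0.
- by rewrite /= mulr0 addr0.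
- by move=> ij ls; rewrite /= update_out // representative_update.
- by [].
(* On the slice [s i = k] the term agrees with a class function, to which [class_function_tight]
   applies. *)
- rewrite (@eq_gain _ _ _ _ (fun s => p0 s * b x i (update (representative s) k))).
    apply: class_function_tight ckl => j s m ms /=.
    by rewrite representative_update.
  by move=> s sk; rewrite /= sk.
- exact: lt_moved.
have b_rep i s : b x i (representative s) = 0.
  by rewrite /b insubN //= /moved_only_at /= ffunE rep_idem eqxx.
case/eqP: x_neq0; apply/ffunP => u; rewrite [RHS]ffunE.
set i := (val u).1; set s := (val u).2.
have := valP u; rewrite /= /moved_only_at => /andP[_ /forallP su].
have {}su j : j != i -> s j = representative s j.
  by move=> ji; have := su j; rewrite ji /= ffunE => /eqP.
have us : update (representative s) (s i) = s by apply: update_eq => // j ij; rewrite su // eq_sym.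
(* The solution takes equal values at [s] and at its representative. All terms vanish at the latter,
   and at [s] only the unknown [x u] survives. *)
have := class_functionP (tight_class_functionM xt) (s := s) (t := representative s).
rewrite (bigD1 (Some i)) //= [X in _ + X]big1 => [|[j|] //= ji]; last first.
  by rewrite su ?update_same ?b_rep.
rewrite big1 => [|[j|] //= _]; last by rewrite representative_idem update_same b_rep.
rewrite addr0 us => <- => [|j]; last by rewrite ffunE rep_idem.
by rewrite /b /i /s -surjective_pairing valK.
Qed.

(** For each choice of classes, [moved] embeds into [moved_profile]. The cardinality bound makes the
    embedding for [t] onto, so it reaches the element built from [s], and comparing coordinates at
    [j] shows that the classes agree. *)
Lemma moved_others i (k : 'I_(d i)) j (s t : profile d) :
  rep k != k -> i != j -> rep (s j) = rep (t j).
Proof.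
move=> kk ij.
have gP r (e : moved) :
    moved_only_at (tag (val e), update (representative r) (tagged (val e))).
  rewrite /moved_only_at /= update_in (valP e); apply/forallP => m; apply/implyP => me.
  by rewrite update_out 1?eq_sym // ffunE rep_idem.
pose g r e : moved_profile := Sub _ (gP r e).
have g_inj r r' e e' : g r e = g r' e' -> e = e'.
  move=> /(congr1 val)/= E; apply: val_inj.
  have := congr1 (fun u : 'I_n * profile d => Tagged (fun i => 'I_(d i)) (u.2 u.1)) E.
  by rewrite /= !update_in !taggedK.
pose e0 : moved := exist _ (Tagged (fun i => 'I_(d i)) k) kk.
have /codomP[e' gE] := inj_card_onto (@g_inj t t) card_moved_profile (g s e0).
have e0e := g_inj _ _ _ _ gE; rewrite -{e'}e0e in gE.
have := congr1 (fun u : moved_profile => (val u).2 j) gE.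
by rewrite /= !update_out // !ffunE.
Qed.

Lemma tight_proportional p : tight p ->
  (exists i (k l : 'I_(d i)), c k l != 0 /\ k != l) ->
  forall s t, p s / p0 s = p t / p0 t.
Proof.
move=> pt [i [k [l [ckl kl]]]] s t.
have [m mm] : exists m : 'I_(d i), rep m != m.
  have [kk|] := eqVneq (rep k) k; last by exists k.
  by exists l; rewrite -(rep_rate ckl) kk.
apply: (class_functionP (tight_class_function pt)) => j.
have [<-{j}|ij] := eqVneq i j; last exact: (moved_others _ _ mm).
(* For player [i] himself, a nontrivial class of another player is enough; the remaining case is
   contradictory. *)
have [/existsP[j /existsP[a /andP[ij aa]]]|] :=
    boolP [exists j, exists a : 'I_(d j), (i != j) && (rep a != a)].
  by apply: (moved_others _ _ aa); rewrite eq_sym.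
move=> nomoved.
(* Were all classes of the others trivial, restricting [p0] to the slice [m] would keep it tight,
   although the indicator separates [m] from [rep m]. *)
suff /tight_class_functionM/(_ i (update s m) (rep m)) :
    tight (fun s : profile d => p0 s * (s i == m)%:R).
  rewrite !update_in rep_idem eqxx (negPf mm) => /(_ erefl)/eqP.
  by rewrite eq_sym oner_eq0.
move=> j a b cab; have [ji|ij] := eqVneq i j.
  case: _ / ji a b cab => a b cab.
  rewrite (@eq_gain _ _ _ _ (fun s => p0 s * (a == m)%:R)) => [|r ->] //.
  by rewrite gainZ p0_tight // mul0r.
have rep_id (a' : 'I_(d j)) : rep a' = a'.
  apply/eqP; apply: contraNT nomoved => aa.
  by apply/existsP; exists j; apply/existsP; exists a'; rewrite ij.
rewrite /gain big1 // => r /eqP ra.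
by rewrite -(rep_id b) -(rep_rate cab) rep_id -ra update_same subrr mul0r.
Qed.

End TightSpace.

(** * The polytope *)

Section CorrelatedEquilibria.
Variables (n : nat) (d : 'I_n -> nat) (R : realType) (X : payoffs d R).
Implicit Types p q : tensor d R.

Definition cone p := forall r, 0 <= (row_form X r p : R).

Lemma row_form_linear r (a : R) p q :
  row_form X r (a *: p + q) = a * row_form X r p + row_form X r q.
Proof.
rewrite !(row_form_basis _ _ (_ : tensor d R)) mulr_sumr -big_split.
by apply: eq_bigr => s _; rewrite /= !ffunE mulrDr mulrCA.
Qed.

Lemma row_form0 r : row_form X r 0 = 0 :> R.
Proof. by rewrite row_form_basis big1 // => s _; rewrite ffunE mulr0. Qed.

Lemma row_formZ r (a : R) p : row_form X r (a *: p) = a * row_form X r p.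
Proof. by rewrite -[a *: p]addr0 row_form_linear row_form0 addr0. Qed.

Lemma row_formD r p q : row_form X r (p + q) = row_form X r p + row_form X r q :> R.
Proof. by rewrite -[p]scale1r row_form_linear mul1r scale1r. Qed.

Lemma row_form_sum (I : finType) r (F : I -> tensor d R) :
  row_form X r (\sum_i F i) = \sum_i (row_form X r (F i) : R).
Proof. exact: (big_morph _ (row_formD r) (row_form0 r)). Qed.

Lemma correlated_equilibriaP p :
  correlated_equilibria X p <-> cone p /\ \sum_s (p s : R) = 1.
Proof.
split=> [[[p_ge0 p1] pX]|[Cp p1]].
  by split=> // -[u|s]; [apply: pX | apply: p_ge0].
split; first by split=> // s; apply: (Cp (inr s)).
move=> i k l; rewrite incentive_form_slice; have [->|kl] := eqVneq k l.
  by rewrite /gain big1 // => s /eqP <-; rewrite update_same subrr mul0r.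
have [u _ <-] := rateE (fun=> 0 : R) kl; exact: Cp.
Qed.

Lemma dual_certificate : exists2 y : row_index d -> R,
  forall q, \sum_r y r * (row_form X r q : R) = 0 &
  forall r, 0 <= y r /\ (0 < y r <-> forall p, cone p -> row_form X r p = 0).
Proof.
have [y yA y_pos] := strict_complementarity (incentive_matrix X).
exists (fun r => y 0 (enum_rank r)) => [q|r].
  have := congr1 (fun M => (M *m tensor_col q) 0 0) yA.
  rewrite mul0mx -mulmxA mxE [RHS]mxE => E0; apply: etrans E0.
  rewrite (reindex _ (onW_bij _ (@enum_val_bij _))); apply: eq_bigr => r _.
  by rewrite enum_valK incentive_matrix_mul.
have [y_ge0 y_gt0] := y_pos (enum_rank r); split => //; split=> [/y_gt0 H p Cp|H].
  rewrite -(enum_rankK r) -incentive_matrix_mul; apply: H => j.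
  by rewrite incentive_matrix_mul; apply: Cp.
apply/y_gt0 => x Ax.
have [q xE] : exists q, x = tensor_col q.
  exists [ffun s => x (enum_rank s) 0].
  by apply/colP => s; rewrite mxE ffunE enum_valK.
rewrite xE incentive_matrix_mul enum_rankK; apply: H => r'.
by have := Ax (enum_rank r'); rewrite xE incentive_matrix_mul enum_rankK.
Qed.

(** The cone is closed under sums, so one witness per form adds up to a point positive on all of
    [A]. The summand [p] keeps the total mass positive for normalization. *)
Lemma relative_interior (A : {pred row_index d}) p : correlated_equilibria X p ->
  (forall r, r \in A -> exists2 q, cone q & row_form X r q != 0) ->
  exists2 q, correlated_equilibria X q & forall r, r \in A -> 0 < (row_form X r q : R).
Proof.
move=> /correlated_equilibriaP[Cp p1] wit.
have /choice[w wP] : forall r, exists q, cone q /\ (r \in A -> row_form X r q != 0).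
  move=> r; case: (boolP (r \in A)) => [/wit[q Cq qr]|rA]; first by exists q.
  by exists p.
pose z : tensor d R := p + \sum_r w r.
have zE r : row_form X r z = row_form X r p + \sum_r' (row_form X r (w r') : R).
  by rewrite row_formD row_form_sum.
have w_ge0 r r' : 0 <= (row_form X r (w r') : R) by have [] := wP r'.
have Cz : cone z.
  by move=> r; rewrite zE addr_ge0 ?sumr_ge0.
have z1 : 0 < \sum_s (z s : R).
  apply: lt_le_trans ltr01 _; rewrite -p1; apply: ler_sum => s _.
  have := zE (inr s) => /= ->; rewrite lerDl sumr_ge0 // => r _.
  exact: (w_ge0 (inr s)).
exists ((\sum_s (z s : R))^-1 *: z).
  apply/correlated_equilibriaP; split=> [r|].
    by rewrite row_formZ mulr_ge0 // invr_ge0 ltW.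
  under eq_bigr do rewrite ffunE.
  by rewrite -mulr_sumr mulVf // gt_eqF.
move=> r rA; rewrite row_formZ mulr_gt0 ?invr_gt0 // zE ltr_wpDl //.
rewrite (bigD1 r) //= ltr_pwDl ?sumr_ge0 //.
by rewrite lt0r w_ge0 andbT; have [_ ->] := wP r.
Qed.

Lemma interior_full_dimensional p : correlated_equilibria X p ->
  (forall r, 0 < (row_form X r p : R)) -> full_dimensional (correlated_equilibria X).
Proof.
move=> Pp p_gt0; have [Cp p1] := (correlated_equilibriaP p).1 Pp.
pose total (x : tensor d R) : R^o := \sum_s (x s : R).
have total_linear : linear total.
  move=> a x y; rewrite /total scaler_sumr -big_split.
  by apply: eq_bigr => s _; rewrite !ffunE.
pose T : {linear tensor d R -> R^o} := HB.pack total (GRing.isLinear.Build _ _ _ _ total total_linear).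
have TE x : linfun T x = total x by rewrite lfunE.
exists p, (lker (linfun T)); split.
  apply/seteqP; split=> x /=.
    case=> m [a [v [Pv a1 ->]]]; rewrite memv_ker TE.
    have -> : total (\sum_i a i *: v i - p) = \sum_i a i *: total (v i) - total p.
      rewrite -[LHS]/(T _) raddfB raddf_sum /=; congr (_ - _).
      by apply: eq_bigr => i _; rewrite -[LHS]/(T _) linearZ.
    rewrite [total p]p1 subr_eq0 -a1; apply/eqP/eq_bigr => i _.
    by have [_] := (correlated_equilibriaP _).1 (Pv i); rewrite /total => ->; rewrite /GRing.scale /= mulr1.
  rewrite memv_ker TE -[total _]/(T _) raddfB /= [total p]p1 subr_eq0 => /eqP x1.
  pose a r := row_form X r p : R; pose b r := row_form X r (x - p) : R.
  (* The sum dominates every ratio, so [e * |b r| <= a r] for all [r] and the step from [p] towards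
     [x] stays in the polytope; the 1 keeps the inverse meaningful. *)
  pose e := (1 + \sum_r `|b r| / a r)^-1.
  have S_ge0 : 0 <= \sum_r `|b r| / a r.
    by apply: sumr_ge0 => r _; rewrite divr_ge0 // ltW ?p_gt0.
  have e_gt0 : 0 < e by rewrite invr_gt0 ltr_pwDl.
  have Py : correlated_equilibria X (e *: (x - p) + p).
    apply/correlated_equilibriaP; split=> [r|]; last first.
      rewrite -[LHS]/(T _) linearP raddfB /= [total x]x1 [total p]p1.
      by rewrite subrr scaler0 add0r.
    rewrite row_form_linear -/(a r) -/(b r) -lerBlDr sub0r.
    have : e * `|b r| <= a r.
      rewrite mulrC ler_pdivrMr ?ltr_pwDl // -ler_pdivrMl ?p_gt0 // mulrC.
      rewrite (bigD1 r) //= addrCA lerDl addr_ge0 ?ler01 ?sumr_ge0 // => r' _.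
      by rewrite divr_ge0 // ltW ?p_gt0.
    move=> H; rewrite lerNl; apply: le_trans H; rewrite -mulrN ler_pM2l //.
    by rewrite -normrN ler_norm.
  exists 2%N, (fun i => if i == 0 then 1 - e^-1 else e^-1).
  exists (fun i => if i == 0 then p else e *: (x - p) + p); split.
  - by move=> i; case: ifP.
  - by rewrite !big_ord_recl big_ord0 /= addr0 subrK.
  - rewrite !big_ord_recl big_ord0 /= addr0 scalerDr scalerA mulVf ?gt_eqF // scale1r.
    by rewrite scalerBl scale1r addrACA addNr addr0 addrC subrK.
have dimT : \dim {: tensor d R} = (\prod_(i < n) d i)%N.
  rewrite dimvf [dim _]dim_ffun card_dep_ffun foldrE big_image /=.
  by apply: eq_bigr => i _; rewrite card_ord.
have dim_img : \dim (limg (linfun T)) = 1%N.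
  apply/eqP; rewrite eqn_leq; apply/andP; split.
    by apply: leq_trans (dimvS (subvf _)) _; rewrite dimvf.
  rewrite lt0n dimv_eq0; apply/negP => /eqP img0.
  have := memv_img (linfun T) (memvf p); rewrite img0 memv0 TE [total p]p1.
  by rewrite oner_eq0.
by rewrite -dimT -(limg_ker_dim (linfun T) fullv) capfv dim_img addnK.
Qed.

Lemma correlated_equilibria_dichotomy : generic_game X ->
  (exists p, correlated_equilibria X p /\ forall i (k : 'I_(d i)), slice p k != 0) ->
  full_dimensional (correlated_equilibria X) \/
  exists p, correlated_equilibria X = [set p]%classic.
Proof.
move=> genX [p1 [Pp1 p1_slice]].
have [y yX y_pos] := dual_certificate.
have y_ge0 r : 0 <= y r by have [] := y_pos r.
have [p0 Pp0 p0_gt0] : exists2 q, correlated_equilibria X q &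
    forall r, y r == 0 -> 0 < (row_form X r q : R).
  apply: (relative_interior (A := [pred r | y r == 0]) Pp1) => r; rewrite inE => /eqP yr.
  have [_ [_ yr_gt0]] := y_pos r; apply: contrapT => nq.
  suff : 0 < y r by rewrite yr ltxx.
  by apply: yr_gt0 => q Cq; apply: contrapT => /eqP qr; apply: nq; exists q.
have cone_tight r p : cone p -> y r != 0 -> row_form X r p = 0.
  by move=> Cp yr; have [_ [-> //]] := y_pos r; rewrite lt0r yr y_ge0.
have [Cp0 p0_sum1] := (correlated_equilibriaP p0).1 Pp0.
have [y0|] := pselect (forall r, y r = 0).
  by left; apply: (interior_full_dimensional Pp0) => r; apply: p0_gt0; rewrite y0.
move=> /existsNP[r0 /eqP yr0]; right; exists p0.
have [Cp1 _] := (correlated_equilibriaP p1).1 Pp1.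
pose sigma i (k : 'I_(d i)) : R := \sum_(s : profile d | s i == k) (p0 s : R).
(* A nonzero entry of the slice of [p1] gives a coordinate that is not tight on the cone, hence has
   weight zero and is positive at [p0]. *)
have sigma_gt0 i (k : 'I_(d i)) : 0 < sigma i k.
  have [j pj] : exists j, slice p1 k j != 0.
    apply: contrapT => /forallNP H; have /eqP := p1_slice i k; apply.
    by apply/ffunP => j; rewrite [RHS]ffunE; apply/eqP/negPn/negP/H.
  rewrite ffunE in pj; set s := insert_strategy k j in pj.
  rewrite /sigma (bigD1 s) /=; last by rewrite insert_strategy_in.
  rewrite ltr_pwDl ?sumr_ge0 // => [|t _]; last exact: (Cp0 (inr t)).
  apply: (p0_gt0 (inr s)); apply: contraNT pj => ys.
  by apply/eqP; apply: (cone_tight (inr s) p1).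
have p0_balanced : forall i, balanced (@rate _ _ _ y i) p0.
  by apply: (generic_balanced genX yX) => r; apply: cone_tight.
(* The product of the marginals of [p0] is positive and stationary too. *)
have y_coord s : y (inr s) = 0.
  pose q : tensor d R := [ffun s : profile d => \prod_i sigma i (s i)].
  have q_gt0 t : 0 < q t by rewrite ffunE; apply: prodr_gt0.
  have q_balanced i : balanced (@rate _ _ _ y i) q.
    move=> t; pose rest : R := \prod_(j | j != i) sigma j (t j).
    have qE k : q (update t k) = sigma i k * rest.
      rewrite ffunE (bigD1 i) //= update_in; congr (_ * _).
      by apply: eq_bigr => j ji; rewrite update_out // eq_sym.
    have -> : q t = sigma i (t i) * rest by rewrite -qE update_same.
    under [RHS]eq_bigr do rewrite qE mulrA.
    under [LHS]eq_bigr do rewrite mulrA.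
    rewrite -[LHS]mulr_suml -[RHS]mulr_suml; congr (_ * _); rewrite /sigma.
    under eq_bigr do rewrite mulr_sumr; under [RHS]eq_bigr do rewrite mulr_sumr.
    rewrite exchange_big /=.
    under [RHS]eq_bigr => l _ do rewrite (sum_update l (t i)).
    rewrite [RHS]exchange_big /=; apply: eq_bigr => s' /eqP <-.
    exact: p0_balanced.
  (* Balance cancels the incentive rows; what remains is a vanishing sum of nonnegative terms
     [y (inr s) * q s] with [q s > 0]. *)
  have := yX q; rewrite big_sumType /= sum_deviation big1 ?add0r => [/eqP|i _]; last first.
    exact: balanced_gain.
  rewrite psumr_eq0 => [/allP/(_ s (mem_index_enum _))/=|t _]; last first.
    by rewrite mulr_ge0 // ltW.
  by rewrite mulf_eq0 [q s == 0]gt_eqF // orbF => /eqP.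
have cone_gain p : cone p -> tight (fun i => X i) (@rate _ _ _ y) p.
  move=> Cp i k l; have [->|kl] := eqVneq k l; first by rewrite rate_diag eqxx.
  by have [u -> <-] := rateE y kl; apply: cone_tight.
have p0_pos s : 0 < p0 s by apply: (p0_gt0 (inr s)); rewrite y_coord.
have tight_balanced (p : profile d -> R) : tight (fun i => X i) (@rate _ _ _ y) p ->
    forall i, balanced (@rate _ _ _ y i) p.
  move=> pt i; have := @generic_balanced _ _ _ X [ffun s => p s] y genX yX.
  have -> : ([ffun s => p s] : tensor d R) = p :> (profile d -> R).
    by apply/funext => s; rewrite ffunE.
  apply=> -[u|s] yr; last by rewrite y_coord eqxx in yr.
  have uE : rate y (tagged (val u)).1 (tagged (val u)).2 = y (inl u).
    by rewrite /rate -surjective_pairing taggedK valK.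
  rewrite /= incentive_form_slice -[RHS](pt _ (tagged (val u)).1 (tagged (val u)).2) ?uE //.
  by apply: eq_gain => s _; rewrite ffunE.
have rate_ge0 i (k l : 'I_(d i)) : 0 <= rate y k l.
  by rewrite /rate; case: insubP.
have moving : exists i (k l : 'I_(d i)), rate y k l != 0 /\ k != l.
  case: r0 yr0 => [u yu|t /eqP]; last by rewrite y_coord.
  exists (tag (val u)), (tagged (val u)).1, (tagged (val u)).2; split.
    by rewrite /rate -surjective_pairing taggedK valK.
  exact: (valP u).
have ratio_eq := tight_proportional rate_ge0 p0_pos (cone_gain _ Cp0) tight_balanced.
apply/seteqP; split=> p /= => [/correlated_equilibriaP[Cp p_sum1]|-> //].
(* Proportional tensors of total mass 1 coincide: [p s * p0 t = p t * p0 s] is summed over [t]. *)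
apply/ffunP => s; rewrite -[LHS](mulr1 (p s : R)) -p0_sum1 -[RHS](mul1r (p0 s : R)) -p_sum1.
rewrite mulr_sumr mulr_suml; apply: eq_bigr => t _.
have /eqP := ratio_eq p (cone_gain p Cp) moving s t.
by rewrite eqr_div ?lt0r_neq0 // => /eqP ->; rewrite mulrC.
Qed.
End CorrelatedEquilibria.

Local Open Scope classical_set_scope.

Theorem theorem1p2 (R : realType) (n : nat) (d : 'I_n -> nat)
  (n_ge2 : (2 <= n)%N) (d_gt0 : forall i : 'I_n, (0 < d i)%N)
  (X : payoffs d R) (X_generic : generic_game X)
  (hp : exists p : tensor d R, correlated_equilibria X p /\
          forall (i : 'I_n) (k : 'I_(d i)), slice p k != 0) :
  full_dimensional (correlated_equilibria X) \/
  exists p : tensor d R, correlated_equilibria X = [set p].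
Proof. exact: correlated_equilibria_dichotomy. Qed.
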